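(* Let $\mathscr{M}=\{m_n\}_{n\in\mathbb{N}_0}$ be a weight sequence and let $R,S\in\mathbb{N}$ with $R+S=N$. Suppose that for each $\eta\in\mathbb{Z}^S$ there is a function $\varphi_\eta\in\mathcal{E}_{\mathscr{M}}(\mathbb{T}^R)$, and that there are positive constants $C,h,\delta$ such that $$|\partial_t^\alpha\varphi_\eta(t)|\le C\cdot h^{|\alpha|}\cdot m_{|\alpha|}\cdot|\alpha|!\cdot\inf_{p\in\mathbb{N}_0}\left(\frac{m_p\cdot p!}{\delta^p(1+|\eta|)^p}\right),\qquad\forall t\in\mathbb{T}^R,\ \forall\alpha\in\mathbb{N}_0^R,\ \forall\eta\in\mathbb{Z}^S.$$ Then $\varphi:\mathbb{T}^N\to\mathbb{C}$ defined by $\varphi(t,x)=\sum_{\eta\in\mathbb{Z}^S}\varphi_\eta(t)\,e^{ix\eta}$ is an element of $\mathcal{E}_{\mathscr{M}}(\mathbb{T}^N)$.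
   Context: $\mathbb{N}=\{1,2,\dots\}$, $\mathbb{N}_0=\mathbb{N}\cup\{0\}$, $\mathbb{T}^N=\mathbb{R}^N/2\pi\mathbb{Z}^N$, and $|\eta|$ is the Euclidean norm of $\eta\in\mathbb{Z}^S$. A weight sequence is a sequence $\mathscr{M}=\{m_n\}_{n\in\mathbb{N}_0}$ of positive reals with: $m_0=m_1=1$; $m_n^2\le m_{n-1}m_{n+1}$ for all $n\in\mathbb{N}$; and there is $H>1$ with $m_{j+k}\le H^{j+k}m_jm_k$ for all $j,k\in\mathbb{N}_0$. For each dimension $d$, $\mathcal{E}_{\mathscr{M}}(\mathbb{T}^d)$ is the space of $f\in C^\infty(\mathbb{T}^d)$ (complex-valued) for which there are $C,h>0$ with $|D^\alpha f(x)|\le C h^{|\alpha|}m_{|\alpha|}|\alpha|!$ for all $x\in\mathbb{T}^d$, $\alpha\in\mathbb{N}_0^d$, where $D=-i\partial$. Points of $\mathbb{T}^N$ are written $(t,x)$ with $t\in\mathbb{T}^R$, $x\in\mathbb{T}^S$. *)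

(* Defs.v *)
From HB Require Import structures.
From mathcomp Require Import all_boot all_order all_algebra.
From mathcomp Require Import finmap.
From mathcomp Require Import all_classical all_reals all_analysis.
From mathcomp Require Export complex.

Set Implicit Arguments.
Unset Strict Implicit.
Unset Printing Implicit Defensive.

Import Order.TTheory GRing.Theory Num.Theory.
Import numFieldNormedType.Exports.
Local Open Scope ring_scope.
Local Open Scope complex_scope.
Local Open Scope classical_set_scope.

(* The modulus of z : R[i] is [Normc.normc z : R]; the norm [`|z|] of the
   numeric field R[i] is the same number, but as an element of R[i]. *)
Notation cabs := Normc.normc.

Definition weight_sequence (R : realType) (m : nat -> R) : Prop :=
  [/\ forall n, 0 < m n,
      m 0%N = 1 /\ m 1%N = 1,
      forall n, (0 < n)%N -> m n ^+ 2 <= m n.-1 * m n.+1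
    & exists2 H : R, 1 < H &
        forall j k, m (j + k)%N <= H ^+ (j + k) * m j * m k].

Section Torus.
Variables (R : realType) (d : nat).

(* Functions on T^d = R^d / 2 pi Z^d are represented by their lifts to R^d;
   derivatives on T^d are those of the lift. *)
Definition periodic2pi (f : 'rV[R]_d -> R[i]) : Prop :=
  forall (x : 'rV[R]_d) (k : 'rV[int]_d),
    f (x + (2 * pi) *: map_mx intr k) = f x.

(* R[i] is a normed module over itself but not over R, so derivatives of
   complex-valued functions of real variables are taken componentwise. *)
Definition re_part (f : 'rV[R]_d -> R[i]) : 'rV[R]_d -> R :=
  fun x => complex.Re (f x).
Definition im_part (f : 'rV[R]_d -> R[i]) : 'rV[R]_d -> R :=
  fun x => complex.Im (f x).

Definition partial (j : 'I_d) (f : 'rV[R]_d -> R[i]) : 'rV[R]_d -> R[i] :=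
  fun x => 'D_(delta_mx 0 j) (re_part f) x +i* 'D_(delta_mx 0 j) (im_part f) x.

Definition Dpartial (j : 'I_d) (f : 'rV[R]_d -> R[i]) : 'rV[R]_d -> R[i] :=
  fun x => - 'i%C * partial j f x.

(* [C^oo]: the partial derivatives of all orders, taken in any order, exist
   everywhere and are continuous. *)
Definition smooth (f : 'rV[R]_d -> R[i]) : Prop :=
  forall s : seq 'I_d, let g := foldr partial f s in
    [/\ continuous (re_part g), continuous (im_part g)
      & forall (j : 'I_d) (x : 'rV[R]_d),
          derivable (re_part g) x (delta_mx 0 j) /\
          derivable (im_part g) x (delta_mx 0 j)].

(* op_0 ^ alpha_0 (op_1 ^ alpha_1 (... f)) *)
Definition multi_deriv (op : 'I_d -> ('rV[R]_d -> R[i]) -> 'rV[R]_d -> R[i])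
    (alpha : 'I_d -> nat) (f : 'rV[R]_d -> R[i]) : 'rV[R]_d -> R[i] :=
  foldr (fun j g => iter (alpha j) (op j) g) f (enum 'I_d).

Definition mlen (alpha : 'I_d -> nat) : nat := (\sum_(j < d) alpha j)%N.

Definition ultradiff (m : nat -> R) : set ('rV[R]_d -> R[i]) :=
  [set f | [/\ periodic2pi f, smooth f &
    exists C h : R, [/\ 0 < C, 0 < h &
      forall (x : 'rV[R]_d) (alpha : 'I_d -> nat),
        cabs (multi_deriv Dpartial alpha f x) <=
        C * h ^+ mlen alpha * m (mlen alpha) * (mlen alpha)`!%:R]]].

Definition eucl (eta : 'rV[int]_d) : R :=
  Num.sqrt (\sum_(j < d) (eta 0 j)%:~R ^+ 2).

(* e^(i x eta) *)
Definition expi (x : 'rV[R]_d) (eta : 'rV[int]_d) : R[i] :=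
  let xeta := \sum_(j < d) x 0 j * (eta 0 j)%:~R in
  cos xeta +i* sin xeta.

End Torus.

Arguments partial {R d} j f.
Arguments Dpartial {R d} j f.

(* Unconditional convergence, along the finite subsets of I directed by
   inclusion; for complex terms this is absolute convergence. *)
Definition has_sum (R : realType) (I : choiceType) (f : I -> R[i]) (l : R[i])
    : Prop :=
  forall e : R, 0 < e -> exists A : {fset I}, forall B : {fset I},
    fsubset A B -> cabs (\sum_(i <- enum_fset B) f i - l) < e.

(* Main.v *)
Require Import Defs.
From HB Require Import structures.
From mathcomp Require Import all_boot all_order all_algebra.
From mathcomp Require Import finmap.
From mathcomp Require Import all_classical all_reals all_analysis.
From mathcomp Require Import ring lra.

Import Order.TTheory GRing.Theory Num.Theory.
Import numFieldNormedType.Exports.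
Local Open Scope ring_scope.
Local Open Scope complex_scope.
Local Open Scope classical_set_scope.

Set Implicit Arguments.
Unset Strict Implicit.
Unset Printing Implicit Defensive.

(** Differentiating phi_eta(t) e^(i x eta) in a direction of t acts on phi_eta
    alone, and in the direction x_j it multiplies the term by i eta_j.  A
    derivative of order a in t and k in x is thus at most
    (1 + |eta|)^k |d_t^a phi_eta|, and the infimum in the hypothesis may be
    bounded by its value at p = k + 2 s: the factor (1 + |eta|)^k cancels and
    (1 + |eta|)^(-2 s) is left over (decay_le), which is summable over Z^s
    because it is dominated by the product of the (1 + |eta_j|)^(-2)
    (lattice_sum_le).

    Every iterated derivative of the terms is therefore dominated by a
    summable family that does not depend on the point.  This makes the sum
    smooth and allows differentiation term by term (termwise_smooth): a
    dominated family of second derivatives gives a quadratic bound on the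
    error of the first order Taylor expansion of the terms, which survives the
    summation and identifies the derivative of the sum; a dominated family of
    first derivatives makes the sum Lipschitz, hence continuous.

    The bound obtained for the derivatives of the sum contains
    h^a m_a a! m_(k + 2 s) (k + 2 s)! / delta^(k + 2 s).  The growth condition
    m_(j + k) <= H^(j + k) m_j m_k and (j + k)! <= 2^(j + k) j! k! split off
    the fixed shift 2 s at the price of a geometric factor
    (weight_shift_le); the log-convexity of the weights gives
    m_a m_k <= m_(a + k), and a! k! <= (a + k)!, so that the two orders
    recombine into the total order a + k (weight_product_le).

    Derivatives along an arbitrary list of directions occur in the definition
    of smoothness, but the hypothesis bounds those taken in the order of the
    coordinates only; the symmetry of second derivatives (derive_swap) reduces
    the former to the latter (partial_bound_any_order). *)

(** * Complex numbers and unconditional sums *)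

Lemma complex_ext (R : realType) (z w : R[i]) :
  complex.Re z = complex.Re w -> complex.Im z = complex.Im w -> z = w.
Proof. by case: z w => [a b] [c d] /= -> ->. Qed.

Lemma Re_mulc (R : realType) (z w : R[i]) : complex.Re (z * w) =
  complex.Re z * complex.Re w - complex.Im z * complex.Im w.
Proof. by case: z w => [a b] [c d]. Qed.

Lemma Im_mulc (R : realType) (z w : R[i]) : complex.Im (z * w) =
  complex.Re z * complex.Im w + complex.Im z * complex.Re w.
Proof. by case: z w => [a b] [c d]. Qed.

Lemma cabs_Re (R : realType) (z : R[i]) : `|complex.Re z| <= cabs z.
Proof.
case: z => a b /=; rewrite -sqrtr_sqr ler_wsqrtr //.
by rewrite lerDl sqr_ge0.
Qed.

Lemma cabs_Im (R : realType) (z : R[i]) : `|complex.Im z| <= cabs z.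
Proof.
case: z => a b /=; rewrite -sqrtr_sqr ler_wsqrtr //.
by rewrite lerDr sqr_ge0.
Qed.

Lemma cabs_le_ReIm (R : realType) (z : R[i]) :
  cabs z <= `|complex.Re z| + `|complex.Im z|.
Proof.
case: z => a b /=; rewrite -[leRHS]ger0_norm ?addr_ge0 //.
rewrite -sqrtr_sqr ler_wsqrtr // sqrrD !real_normK ?num_real //.
by rewrite -addrA lerD2l lerDr mulrn_wge0 // mulr_ge0.
Qed.

Lemma cabs_ge0 (R : realType) (z : R[i]) : 0 <= cabs z.
Proof. exact: le_trans (normr_ge0 _) (cabs_Re _). Qed.

(** The triangle inequality on [R[i]] itself rather than on its real alias. *)
Lemma ler_cabsD (R : realType) (z w : R[i]) : cabs (z + w) <= cabs z + cabs w.
Proof. exact: le_normcD. Qed.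

Lemma cabsN (R : realType) (z : R[i]) : cabs (- z) = cabs z.
Proof. exact: normcN. Qed.

Lemma cabs_Real (R : realType) (a : R) : cabs a%:C = `|a|.
Proof. by rewrite /= expr0n addr0 sqrtr_sqr. Qed.

Lemma cabsX (R : realType) (z : R[i]) n : cabs (z ^+ n) = cabs z ^+ n.
Proof.
by elim: n => [|n IH]; rewrite ?expr0 ?Normc.normc1 // !exprS Normc.normcM IH.
Qed.

Lemma cabs_i (R : realType) : cabs ('i%C : R[i]) = 1.
Proof. by rewrite /= expr0n expr1n add0r sqrtr1. Qed.

Lemma ler_cabs_sum (R : realType) (I : Type) (r : seq I) (f : I -> R[i]) :
  cabs (\sum_(i <- r) f i) <= \sum_(i <- r) cabs (f i).
Proof.
elim: r => [|i r IH]; first by rewrite !big_nil Normc.normc0.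
rewrite !big_cons (le_trans (ler_cabsD _ _)) // lerD2l //.
Qed.

Lemma ler_sum_subset (R : realType) (T : eqType) (r1 r2 : seq T) (F : T -> R) :
  (forall x, 0 <= F x) -> uniq r1 -> uniq r2 -> {subset r1 <= r2} ->
  \sum_(x <- r1) F x <= \sum_(x <- r2) F x.
Proof.
move=> F0 u1 u2 s12.
have p : perm_eq r2 (r1 ++ [seq x <- r2 | x \notin r1]).
  apply: uniq_perm => //; first rewrite cat_uniq u1 filter_uniq // andbT.
    by apply/hasPn => x; rewrite mem_filter => /andP[].
  move=> x; rewrite mem_cat mem_filter; case: (boolP (x \in r1)) => //=.
  exact: s12.
by rewrite (perm_big _ p) /= big_cat /= lerDl sumr_ge0.
Qed.

(** The sum is the supremum of the finite sums: finite sums of nonnegative terms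
    increase with the index set, so all those over a superset of an almost
    optimal set are almost optimal. *)
Lemma nonneg_sum_exists (R : realType) (I : choiceType) (a : I -> R) (K : R) :
  (forall i, 0 <= a i) ->
  (forall B : {fset I}, \sum_(i <- enum_fset B) a i <= K) ->
  exists l : R, forall e : R, 0 < e -> exists A : {fset I},
    forall B : {fset I}, fsubset A B -> `|\sum_(i <- enum_fset B) a i - l| < e.
Proof.
move=> a0 aK; pose E := range (fun B : {fset I} => \sum_(i <- enum_fset B) a i).
have supE : has_sup E.
  split; first by exists (\sum_(i <- enum_fset (fset0 : {fset I})) a i), fset0.
  by exists K => _ [B _ <-].
exists (sup E) => e e0; have [_ [A _ <-] lA] := sup_adherent e0 supE.
exists A => B /fsubsetP AB.
have AB' := @ler_sum_subset R I _ _ a a0 (fset_uniq A) (fset_uniq B) AB.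
have BE : \sum_(i <- enum_fset B) a i <= sup E.
  by apply: ub_le_sup; [exact: supE.2|exists B].
by rewrite ler0_norm ?subr_le0 // opprB ltrBlDl -ltrBlDr (lt_le_trans lA).
Qed.

Lemma abs_sum_exists (R : realType) (I : choiceType) (a : I -> R) (K : R) :
  (forall B : {fset I}, \sum_(i <- enum_fset B) `|a i| <= K) ->
  exists l : R, forall e : R, 0 < e -> exists A : {fset I},
    forall B : {fset I}, fsubset A B -> `|\sum_(i <- enum_fset B) a i - l| < e.
Proof.
move=> aK.
have [//|//|l1 h1] := @nonneg_sum_exists R I (fun i => `|a i|) K.
(* a = (|a| + a) - |a| is a difference of nonnegative families *)
have [|B|l2 h2] := @nonneg_sum_exists R I (fun i => `|a i| + a i) (K *+ 2).
- by move=> i; rewrite -lerBlDr sub0r ler_normr lexx orbT.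
- rewrite mulr2n (le_trans _ (lerD (aK B) (aK B))) // big_split lerD2l /=.
  by apply: ler_sum => i _; exact: ler_norm.
exists (l2 - l1) => e e0.
have e2 : 0 < e / 2 by rewrite divr_gt0.
have [A1 hA1] := h1 _ e2; have [A2 hA2] := h2 _ e2.
exists (fsetU A1 A2) => B; rewrite fsubUset => /andP[/hA1 b1 /hA2 b2].
rewrite big_split /= in b2.
have -> : \sum_(i <- enum_fset B) a i - (l2 - l1) =
   (\sum_(i <- enum_fset B) `|a i| + \sum_(i <- enum_fset B) a i - l2) -
   (\sum_(i <- enum_fset B) `|a i| - l1) by ring.
by rewrite (le_lt_trans (ler_normB _ _)) // [ltRHS]splitr ltrD.
Qed.

Definition finite_sums_le (R : realType) (I : choiceType) (f : I -> R)
    (K : R) :=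
  forall B : {fset I}, \sum_(i <- enum_fset B) f i <= K.

Lemma Re_sum (R : realType) (I : Type) (r : seq I) (f : I -> R[i]) :
  complex.Re (\sum_(i <- r) f i) = \sum_(i <- r) complex.Re (f i).
Proof. exact: raddf_sum. Qed.

Lemma Im_sum (R : realType) (I : Type) (r : seq I) (f : I -> R[i]) :
  complex.Im (\sum_(i <- r) f i) = \sum_(i <- r) complex.Im (f i).
Proof. exact: raddf_sum. Qed.

(** The first order Taylor remainder of a complex function has the remainders of
    its components as components. *)
Lemma Re_sub2_realM (R : realType) (t : R) (x y z : R[i]) :
  complex.Re (x - y - t%:C * z) =
  complex.Re x - complex.Re y - t * complex.Re z.
Proof. by case: x y z => [a b] [c d] [e f] /=; ring. Qed.

Lemma Im_sub2_realM (R : realType) (t : R) (x y z : R[i]) :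
  complex.Im (x - y - t%:C * z) =
  complex.Im x - complex.Im y - t * complex.Im z.
Proof. by case: x y z => [a b] [c d] [e f] /=; ring. Qed.

Lemma has_sum_exists (R : realType) (I : choiceType) (f : I -> R[i])
    (b : I -> R) (K : R) :
  (forall i, cabs (f i) <= b i) -> finite_sums_le b K -> exists l, has_sum f l.
Proof.
move=> fb bK.
have [B|lr hr] := @abs_sum_exists R I (fun i => complex.Re (f i)) K.
  apply: le_trans (bK B); apply: ler_sum => i _.
  exact: le_trans (cabs_Re _) (fb _).
have [B|li hi] := @abs_sum_exists R I (fun i => complex.Im (f i)) K.
  apply: le_trans (bK B); apply: ler_sum => i _.
  exact: le_trans (cabs_Im _) (fb _).
exists (lr +i* li) => e e0.
have e2 : 0 < e / 2 by rewrite divr_gt0.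
have [A1 hA1] := hr _ e2; have [A2 hA2] := hi _ e2.
exists (fsetU A1 A2) => B; rewrite fsubUset => /andP[/hA1 b1 /hA2 b2].
rewrite (le_lt_trans (cabs_le_ReIm _)) // [ltRHS]splitr.
rewrite !raddfB /= Re_sum Im_sum; exact: ltrD.
Qed.

Lemma has_sum_norm_le (R : realType) (I : choiceType) (f : I -> R[i])
    (b : I -> R) (K : R) l :
  has_sum f l -> (forall i, cabs (f i) <= b i) -> finite_sums_le b K ->
  cabs l <= K.
Proof.
move=> hf fb bK; apply/ler_addgt0Pr => e e0; have [A /(_ A)] := hf _ e0.
rewrite fsubset_refl => /(_ isT) hA.
have -> : l = \sum_(i <- enum_fset A) f i - (\sum_(i <- enum_fset A) f i - l).
  by rewrite opprB addrC subrK.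
rewrite (le_trans (ler_cabsD _ _)) // cabsN lerD //; last exact: ltW.
apply: le_trans (ler_cabs_sum _ _) _; apply: le_trans (bK A).
by apply: ler_sum => i _; exact: fb.
Qed.

Lemma has_sumD (R : realType) (I : choiceType) (f g : I -> R[i]) k l :
  has_sum f k -> has_sum g l -> has_sum (fun i => f i + g i) (k + l).
Proof.
move=> hf hg e e0.
have e2 : 0 < e / 2 by rewrite divr_gt0.
have [A1 hA1] := hf _ e2; have [A2 hA2] := hg _ e2.
exists (fsetU A1 A2) => B; rewrite fsubUset => /andP[/hA1 b1 /hA2 b2].
rewrite big_split opprD addrACA (le_lt_trans (ler_cabsD _ _)) //.
by rewrite [ltRHS]splitr ltrD.
Qed.

Lemma has_sumZ (R : realType) (I : choiceType) (f : I -> R[i]) (c : R[i]) l :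
  has_sum f l -> has_sum (fun i => c * f i) (c * l).
Proof.
move=> hf e e0.
have c0 := cabs_ge0 c.
have c1 : 0 < cabs c + 1 by rewrite ltr_wpDl.
have [A hA] := hf (e / (cabs c + 1)) (divr_gt0 e0 c1).
(* dividing by |c| + 1 rather than |c| covers c = 0 *)
exists A => B /hA; rewrite -mulr_sumr -mulrBr Normc.normcM.
rewrite ltr_pdivlMr // mulrC; apply: le_lt_trans.
by rewrite ler_wpM2r ?cabs_ge0 // lerDl.
Qed.

Lemma has_sumB (R : realType) (I : choiceType) (f g : I -> R[i]) k l :
  has_sum f k -> has_sum g l -> has_sum (fun i => f i - g i) (k - l).
Proof.
move=> hf hg; rewrite -mulN1r; have := has_sumD hf (has_sumZ (-1) hg).
by congr has_sum; apply/funext => i; rewrite mulN1r.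
Qed.

Lemma has_sum_unique (R : realType) (I : choiceType) (f : I -> R[i]) k l :
  has_sum f k -> has_sum f l -> k = l.
Proof.
move=> hk hl; apply/eqP; rewrite -subr_eq0; apply/eqP/Normc.eq0_normc.
apply/eqP; rewrite eq_le cabs_ge0 andbT.
apply: (has_sum_norm_le (b := fun=> 0) (has_sumB hk hl)).
  by move=> i; rewrite subrr Normc.normc0.
by move=> B; rewrite big1.
Qed.

(** * Directional derivatives *)

(** A directional derivative depends only on the restriction of the function to
    a line; the two functions may live on different spaces. *)
Lemma is_derive_along (R : realType) (V V' : normedModType R)
    (f : V -> R) (f' : V' -> R) x v x' v' d :
  (forall h : R, f (h *: v + x) = f' (h *: v' + x')) ->
  is_derive x' v' f' d -> is_derive x v f d.
Proof.
move=> E [D <-].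
have e : (fun h : R => h^-1 *: ((f \o shift x) (h *: v) - f x)) =
         (fun h : R => h^-1 *: ((f' \o shift x') (h *: v') - f' x')).
  apply/funext => h /=; have := E 0; rewrite !scale0r !add0r => <-.
  by rewrite E.
by split; rewrite ?/derivable ?/derive e.
Qed.

(** With the intermediate point located by [`|c| <= `|t|] the statement does not
    depend on the sign of t. *)
Lemma line_MVT (R : realType) (V : normedModType R) (f g : V -> R) v :
  (forall x, is_derive x v f (g x)) ->
  forall x (t : R), exists2 c : R, `|c| <= `|t| &
    f (t *: v + x) - f x = t * g (c *: v + x).
Proof.
move=> fg x t; pose F (u : R) := f (u *: v + x).
have dF (u : R) : is_derive u 1 F (g (u *: v + x)).
  apply: is_derive_along (fg _) => h.
  by rewrite /F addrA -scalerDl /GRing.scale /= mulr1.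
have cF : continuous F.
  move=> u; apply: differentiable_continuous; apply/derivable1_diffP.
  exact: ex_derive.
case: (leP 0 t) => t0.
  have [|c] := MVT_segment t0 (fun u _ => dF u).
    exact: continuous_subspaceT.
  rewrite /= in_itv /= => /andP[c0 ct] E; exists c.
    by rewrite !ger0_norm.
  by move: E; rewrite /F scale0r add0r subr0 mulrC.
have [|c] := MVT_segment (ltW t0) (fun u _ => dF u).
  exact: continuous_subspaceT.
rewrite /= in_itv /= => /andP[tc c0] E; exists c.
  by rewrite !ler0_norm ?lerN2 // ltW.
apply: oppr_inj; rewrite opprB mulrC -mulrN.
by move: E; rewrite /F scale0r add0r sub0r.
Qed.

(** The mean value theorem, applied to f and then to its derivative. *)
Lemma taylor1_le (R : realType) (V : normedModType R) (f g k : V -> R) v b :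
  (forall x, is_derive x v f (g x)) -> (forall x, is_derive x v g (k x)) ->
  (forall x, `|k x| <= b) ->
  forall x (t : R), `|f (t *: v + x) - f x - t * g x| <= b * t ^+ 2.
Proof.
move=> fg gk kb x t.
have [c ct ->] := line_MVT fg x t; rewrite -mulrBr.
have [c' _ ->] := line_MVT gk x c.
rewrite !normrM mulrA [leRHS]mulrC -real_normK ?num_real // expr2.
by apply: ler_pM => //; rewrite ler_wpM2l.
Qed.

(** Converse of [taylor1_le]: unlike derivability, a quadratic bound on the
    remainder passes to sums of dominated families. *)
Lemma is_derive_quadratic (R : realType) (V : normedModType R) (f : V -> R)
    x v d (K : R) :
  (forall t : R, `|f (t *: v + x) - f x - t * d| <= K * t ^+ 2) ->
  is_derive x v f d.
Proof.
move=> H.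
have K0 : 0 <= K by have := H 1; rewrite expr1n mulr1; exact: le_trans.
have cv : h^-1 *: ((f \o shift x) (h *: v) - f x) @[h --> (0:R)^'] --> d.
  apply/cvgrPdist_le => e e0.
  have K1 : 0 < e / (K + 1) by rewrite divr_gt0 // ltr_wpDl.
  near=> t.
  have t0 : t != 0 by near: t; exact: nbhs_dnbhs_neq.
  have -> : d - t^-1 *: ((f \o shift x) (t *: v) - f x) =
            - (t^-1 * (f (t *: v + x) - f x - t * d)).
    by rewrite [LHS]/= mulrBr mulKf // opprB.
  rewrite normrN normrM normfV ler_pdivrMl ?normr_gt0 //.
  apply: le_trans (H t) _; rewrite -real_normK ?num_real // expr2 mulrCA.
  rewrite ler_wpM2l // mulrC.
  have : `|t| <= e / (K + 1).
    near: t; apply: dnbhs0_le => //.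
  rewrite ler_pdivlMr ?ltr_wpDl // => /(le_trans _); apply.
  by rewrite ler_wpM2l // lerDl.
split; first by apply/cvg_ex; exists d.
by apply: cvg_lim => //.
Unshelve. all: by end_near. Qed.

(** The increment of f along w is derivable along v, so the mean value theorem
    applies to it, and then to the derivative of f. *)
Lemma second_difference (R : realType) (V : normedModType R)
    (f fv fvw : V -> R) v w :
  (forall x, is_derive x v f (fv x)) -> (forall x, is_derive x w fv (fvw x)) ->
  forall x (t : R), exists c c' : R, [/\ `|c| <= `|t|, `|c'| <= `|t| &
    f (t *: w + (t *: v + x)) - f (t *: v + x) - (f (t *: w + x) - f x) =
    t * (t * fvw (c' *: w + (c *: v + x)))].
Proof.
move=> dv dvw x t; pose G y := f (t *: w + y) - f y.
have dG y : is_derive y v G (fv (t *: w + y) - fv y).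
  apply: is_deriveB; apply: is_derive_along (dv _) => h.
  by congr f; rewrite addrCA.
have [c ct E] := line_MVT dG x t.
have [c' ct' E'] := line_MVT dvw (c *: v + x) t.
by exists c, c'; split=> //; rewrite -E'.
Qed.

(** Symmetry of second derivatives: the same second difference is t^2 times a
    value of either mixed derivative at a point tending to x with t. *)
Lemma derive_swap (R : realType) (V : normedModType R)
    (f fv fw fvw fwv : V -> R) v w :
  (forall x, is_derive x v f (fv x)) -> (forall x, is_derive x w f (fw x)) ->
  (forall x, is_derive x w fv (fvw x)) -> (forall x, is_derive x v fw (fwv x)) ->
  continuous fvw -> continuous fwv -> fvw =1 fwv.
Proof.
move=> dv dw dvw dwv cvw cwv x.
apply/eqP; rewrite -subr_eq0 -normr_eq0 eq_le normr_ge0 andbT.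
apply/ler_addgt0Pr => e e0; rewrite add0r.
have e2 : 0 < e / 2 by rewrite divr_gt0.
have /cvgrPdist_le /(_ _ e2) := cvw x; have /cvgrPdist_le /(_ _ e2) := cwv x.
rewrite !near_simpl => n2 n1.
have : \forall y \near x, `|fvw x - fvw y| <= e / 2 /\ `|fwv x - fwv y| <= e / 2.
  by near=> y; split; near: y.
move=> /nbhs_normP[d /= d0 hd].
have vw0 : 0 < `|v| + `|w| + 1 by rewrite ltr_wpDl ?addr_ge0.
pose t := d / (`|v| + `|w| + 1).
have t0 : 0 < t by rewrite divr_gt0.
(* t is small enough for all intermediate points to be within d of x *)
have close (c c' : R) : `|c| <= `|t| -> `|c'| <= `|t| ->
    `|c *: v + c' *: w| < d.
  rewrite (gtr0_norm t0) => ct ct'.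
  have -> : d = t * (`|v| + `|w| + 1) by rewrite divfK // gt_eqF.
  rewrite (le_lt_trans (ler_normD _ _)) // !normrZ !mulrDr mulr1.
  rewrite (@le_lt_trans _ _ (t * `|v| + t * `|w|)) ?ltrDl //.
  by rewrite lerD // ler_wpM2r.
have [c [c' [ct ct' E1]]] := second_difference dv dvw x t.
have [k [k' [kt kt' E2]]] := second_difference dw dwv x t.
have E : fvw (c' *: w + (c *: v + x)) = fwv (k' *: v + (k *: w + x)).
  apply: (mulfI (lt0r_neq0 t0)); apply: (mulfI (lt0r_neq0 t0)).
  rewrite -E1 -E2 [t *: w + (t *: v + x)]addrCA; ring.
have [] := hd (c' *: w + (c *: v + x)).
  rewrite /ball_ /= addrA opprD addrCA subrr addr0 normrN addrC.
  by rewrite addrC [_ + c *: v]addrC close.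
move=> h1 _; have [] := hd (k' *: v + (k *: w + x)).
  by rewrite /ball_ /= addrA opprD addrCA subrr addr0 normrN close.
move=> _ h2.
have -> : fvw x - fwv x = (fvw x - fvw (c' *: w + (c *: v + x))) -
   (fwv x - fwv (k' *: v + (k *: w + x))) by rewrite E; ring.
by rewrite (le_trans (ler_normB _ _)) // [leRHS]splitr lerD.
Unshelve. all: by end_near. Qed.

Lemma ler_coord_norm (R : realType) d (x : 'rV[R]_d) j : `|x 0 j| <= `|x|.
Proof.
have -> : `|x| = mx_norm x by [].
by rewrite mx_normrE (le_bigmax _ (fun ij => `|x ij.1 ij.2|) (0, j)).
Qed.

(** Going from y to x along the coordinate directions, one after the other, each
    step is controlled by one partial derivative. *)
Lemma lipschitz_of_partials (R : realType) d (f : 'rV[R]_d -> R)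
    (g : 'I_d -> 'rV[R]_d -> R) (b : 'I_d -> R) :
  (forall j x, is_derive x (delta_mx 0 j) f (g j x)) ->
  (forall j x, `|g j x| <= b j) ->
  forall x y, `|f x - f y| <= (\sum_j b j) * `|x - y|.
Proof.
move=> dg gb x y.
(* any list of directions is allowed, to make induction possible *)
have walk (s : seq 'I_d) (a : 'I_d -> R) :
    `|f (\sum_(j <- s) a j *: delta_mx 0 j + y) - f y| <=
    \sum_(j <- s) b j * `|a j|.
  elim: s => [|j s IH]; first by rewrite !big_nil add0r subrr normr0.
  rewrite !big_cons -addrA; set z := _ + y in IH *.
  have -> : f (a j *: delta_mx 0 j + z) - f y =
    (f (a j *: delta_mx 0 j + z) - f z) + (f z - f y) by ring.
  rewrite (le_trans (ler_normD _ _)) // lerD //.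
  have [c _ ->] := line_MVT (dg j) z (a j).
  by rewrite normrM mulrC ler_wpM2r.
have := walk (index_enum 'I_d) (fun j => (x - y) 0 j).
rewrite -row_sum_delta subrK => /le_trans; apply.
rewrite mulr_suml ler_sum // => j _; rewrite ler_wpM2l ?ler_coord_norm //.
exact: le_trans (gb j 0).
Qed.

Lemma lipschitz_continuous (R : realType) (V : normedModType R) (f : V -> R) K :
  (forall x y, `|f x - f y| <= K * `|x - y|) -> continuous f.
Proof.
move=> L x; apply/cvgrPdist_le => e e0.
have K1 : 0 < `|K| + 1 by rewrite ltr_wpDl.
near=> y; apply: (le_trans (L _ _)).
have : `|x - y| <= e / (`|K| + 1).
  near: y; apply: (@cvgr_dist_le _ _ _ (nbhs x) _ id x) => //.
  by rewrite divr_gt0.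
rewrite ler_pdivlMr // => /(le_trans _); apply.
rewrite mulrC ler_wpM2l // (le_trans (ler_norm _)) // lerDl //.
Unshelve. all: by end_near. Qed.

(** * Differentiation term by term *)

(** [smooth] without continuity. *)
Definition has_partials (R : realType) d (f : 'rV[R]_d -> R[i]) :=
  forall (l : seq 'I_d) (j : 'I_d) (x : 'rV[R]_d),
    derivable (re_part (foldr partial f l)) x (delta_mx 0 j) /\
    derivable (im_part (foldr partial f l)) x (delta_mx 0 j).

Lemma has_partials_Re (R : realType) d (f : 'rV[R]_d -> R[i]) :
  has_partials f -> forall l j x, is_derive x (delta_mx 0 j)
    (re_part (foldr partial f l)) (re_part (foldr partial f (j :: l)) x).
Proof. by move=> df l j x; split=> //; have [] := df l j x. Qed.

Lemma has_partials_Im (R : realType) d (f : 'rV[R]_d -> R[i]) :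
  has_partials f -> forall l j x, is_derive x (delta_mx 0 j)
    (im_part (foldr partial f l)) (im_part (foldr partial f (j :: l)) x).
Proof. by move=> df l j x; split=> //; have [] := df l j x. Qed.

(** Summation preserves the quadratic bounds on the Taylor remainders of the
    terms, with the sum of the bounds on the second derivatives as constant.  So
    the sums of the derivatives are the derivatives of the sum, and they are
    continuous because their own partial derivatives are bounded. *)
Theorem termwise_smooth (R : realType) d (I : choiceType)
    (F : I -> 'rV[R]_d -> R[i]) (b : seq 'I_d -> I -> R) (K : seq 'I_d -> R) :
  (forall i, has_partials (F i)) ->
  (forall i l x, cabs (foldr partial (F i) l x) <= b l i) ->
  (forall l, finite_sums_le (b l) (K l)) ->
  exists2 Phi, smooth Phi &
    forall l x,
      has_sum (fun i => foldr partial (F i) l x) (foldr partial Phi l x).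
Proof.
move=> dF Fb bK.
have /choice[G hG] : forall lx : seq 'I_d * 'rV[R]_d, exists z,
    has_sum (fun i => foldr partial (F i) lx.1 lx.2) z.
  by move=> [l x] /=; apply: has_sum_exists (bK l) => i; exact: Fb.
(* G (l, x) is the sum at x of the derivatives along l *)
have quad l j x (t : R) :
    cabs (G (l, t *: delta_mx 0 j + x) - G (l, x) - t%:C * G (j :: l, x)) <=
    (K (j :: j :: l) *+ 2) * t ^+ 2.
  have h := has_sumB (has_sumB (hG (l, t *: delta_mx 0 j + x)) (hG (l, x)))
     (has_sumZ t%:C (hG (j :: l, x))).
  apply: (has_sum_norm_le (b := fun i => (b (j :: j :: l) i *+ 2) * t ^+ 2) h).
    move=> i /=; rewrite (le_trans (cabs_le_ReIm _)) // mulr2n mulrDl lerD //.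
      rewrite Re_sub2_realM.
      have B x' :
          `|re_part (foldr partial (F i) (j :: j :: l)) x'| <= b (j :: j :: l) i.
        exact: le_trans (cabs_Re _) (Fb _ _ _).
      exact: (taylor1_le (has_partials_Re (dF i) l j)
                (has_partials_Re (dF i) (j :: l) j) B).
    rewrite Im_sub2_realM.
    have B x' :
        `|im_part (foldr partial (F i) (j :: j :: l)) x'| <= b (j :: j :: l) i.
      exact: le_trans (cabs_Im _) (Fb _ _ _).
    exact: (taylor1_le (has_partials_Im (dF i) l j)
              (has_partials_Im (dF i) (j :: l) j) B).
  move=> B; rewrite -mulr_suml ler_wpM2r ?sqr_ge0 // sumrMnl lerMn2r /=.
  exact: bK.
pose H l x := G (l, x).
have dRe l j x :
    is_derive x (delta_mx 0 j) (re_part (H l)) (re_part (H (j :: l)) x).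
  apply: (@is_derive_quadratic _ _ _ _ _ _ (K (j :: j :: l) *+ 2)) => t.
  apply: le_trans (quad l j x t); apply: le_trans (cabs_Re _).
  by rewrite Re_sub2_realM.
have dIm l j x :
    is_derive x (delta_mx 0 j) (im_part (H l)) (im_part (H (j :: l)) x).
  apply: (@is_derive_quadratic _ _ _ _ _ _ (K (j :: j :: l) *+ 2)) => t.
  apply: le_trans (quad l j x t); apply: le_trans (cabs_Im _).
  by rewrite Im_sub2_realM.
have HE l : foldr partial (H [::]) l = H l.
  elim: l => //= j l ->; apply/funext => x; rewrite /partial.
  rewrite (@derive_val _ _ _ _ _ _ _ (dRe l j x)).
  rewrite (@derive_val _ _ _ _ _ _ _ (dIm l j x)) /re_part /im_part.
  by case: (H (j :: l) x).
have Hb l x : cabs (H l x) <= K l.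
  by apply: (has_sum_norm_le (hG (l, x)) _ (bK l)) => i; exact: Fb.
exists (H [::]) => [l g|l x]; last by rewrite HE; exact: (hG (l, x)).
rewrite /g HE; split.
- apply: (@lipschitz_continuous _ _ _ (\sum_j K (j :: l))).
  apply: (lipschitz_of_partials (dRe l)) => j x.
  exact: le_trans (cabs_Re _) (Hb _ _).
- apply: (@lipschitz_continuous _ _ _ (\sum_j K (j :: l))).
  apply: (lipschitz_of_partials (dIm l)) => j x.
  exact: le_trans (cabs_Im _) (Hb _ _).
- by move=> j x; split; [have [] := dRe l j x|have [] := dIm l j x].
Qed.

(** * Order of differentiation *)

Lemma smooth_has_partials (R : realType) d (f : 'rV[R]_d -> R[i]) :
  smooth f -> has_partials f.
Proof. by move=> sf l; have [_ _] := sf l. Qed.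

Lemma partial_swap (R : realType) d (f : 'rV[R]_d -> R[i]) i j l :
  smooth f -> foldr partial f [:: i, j & l] = foldr partial f [:: j, i & l].
Proof.
move=> sf; have pf := smooth_has_partials sf; apply/funext => x.
have [ci1 ci2 _] := sf [:: i, j & l]; have [cj1 cj2 _] := sf [:: j, i & l].
have eRe := derive_swap (has_partials_Re pf l i) (has_partials_Re pf l j)
  (has_partials_Re pf (i :: l) j) (has_partials_Re pf (j :: l) i) cj1 ci1 x.
have eIm := derive_swap (has_partials_Im pf l i) (has_partials_Im pf l j)
  (has_partials_Im pf (i :: l) j) (has_partials_Im pf (j :: l) i) cj2 ci2 x.
by apply: complex_ext; [exact: (esym eRe)|exact: (esym eIm)].
Qed.

(** Moving one direction through the list by successive swaps gives all
    permutations. *)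
Lemma partial_perm (R : realType) d (f : 'rV[R]_d -> R[i]) l l' :
  smooth f -> perm_eq l l' -> foldr partial f l = foldr partial f l'.
Proof.
move=> sf.
have front j l1 l2 : foldr partial f (l1 ++ j :: l2) =
    foldr partial f (j :: l1 ++ l2).
  elim: l1 => //= i l1 ->; exact: (@partial_swap _ _ f i j (l1 ++ l2)).
elim: l l' => [|j l IH] l' p.
  by have -> : l' = [::] by apply/perm_nilP; rewrite perm_sym.
have jl' : j \in l' by rewrite -(perm_mem p) mem_head.
case/splitPr: jl' p => l1 l2 p.
rewrite front /= (IH (l1 ++ l2)) //.
by move: p; rewrite perm_sym -[j :: l2]cat1s perm_catCA perm_cons perm_sym.
Qed.

(** The list of directions along which [multi_deriv] differentiates. *)
Definition multi_seq d (alpha : 'I_d -> nat) : seq 'I_d :=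
  flatten [seq nseq (alpha j) j | j <- enum 'I_d].

Lemma multi_derivE (R : realType) d op (alpha : 'I_d -> nat)
    (f : 'rV[R]_d -> R[i]) :
  multi_deriv op alpha f = foldr op f (multi_seq alpha).
Proof.
rewrite /multi_deriv /multi_seq; elim: (enum 'I_d) => //= j s ->.
rewrite foldr_cat; elim: (alpha j) => //= n -> //.
Qed.

Lemma size_multi_seq d (alpha : 'I_d -> nat) :
  size (multi_seq alpha) = mlen alpha.
Proof.
rewrite /multi_seq /mlen -big_enum /=; elim: (enum 'I_d) => [|j s IH] /=.
  by rewrite big_nil.
by rewrite big_cons size_cat size_nseq IH.
Qed.

Lemma multi_seq_count d (l : seq 'I_d) :
  perm_eq l (multi_seq (fun j => count_mem j l)).
Proof.
apply/allP => j _ /=; apply/eqP; rewrite /multi_seq count_flatten -map_comp.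
rewrite sumnE big_map big_enum /= (bigD1 j) //= count_nseq /= eqxx mul1n.
rewrite big1 ?addn0 // => k kj.
by rewrite /= count_nseq /= (negbTE kj) mul0n.
Qed.

(** Every list of directions is a permutation of the [multi_seq] of its own
    multiplicities. *)
Lemma partial_bound_any_order (R : realType) d (f : 'rV[R]_d -> R[i])
    (b : nat -> R) x : smooth f ->
  (forall alpha, cabs (multi_deriv partial alpha f x) <= b (mlen alpha)) ->
  forall l, cabs (foldr partial f l x) <= b (size l).
Proof.
move=> sf fb l; have p := multi_seq_count l.
by rewrite (partial_perm sf p) (perm_size p) -multi_derivE size_multi_seq.
Qed.

Lemma partialZ (R : realType) d (f : 'rV[R]_d -> R[i]) (c : R[i]) j :
  (forall x, derivable (re_part f) x (delta_mx 0 j)) ->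
  (forall x, derivable (im_part f) x (delta_mx 0 j)) ->
  partial j (fun x => c * f x) = (fun x => c * partial j f x).
Proof.
move=> dr di; apply/funext => x; rewrite /partial.
have -> : re_part (fun x => c * f x) =
    complex.Re c *: re_part f - complex.Im c *: im_part f.
  by apply/funext => y; exact: Re_mulc.
have -> : im_part (fun x => c * f x) =
    complex.Re c *: im_part f + complex.Im c *: re_part f.
  by apply/funext => y; exact: Im_mulc.
rewrite deriveB ?deriveD ?deriveZ //; [idtac|exact: derivableZ..].
by apply: complex_ext; rewrite ?Re_mulc ?Im_mulc.
Qed.

Lemma foldr_Dpartial (R : realType) d (f : 'rV[R]_d -> R[i]) l :
  has_partials f ->
  foldr Dpartial f l = (fun x => (- 'i%C) ^+ size l * foldr partial f l x).
Proof.
move=> pf; elim: l => [|j l IH] /=.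
  by apply/funext => x; rewrite expr0 mul1r.
rewrite IH /Dpartial.
rewrite (partialZ _ (fun x => (pf l j x).1) (fun x => (pf l j x).2)).
by apply/funext => x; rewrite exprS mulrA.
Qed.

(** [Dpartial] and [partial] differ by a factor of modulus 1. *)
Lemma cabs_multi_Dpartial (R : realType) d (f : 'rV[R]_d -> R[i]) alpha x :
  has_partials f ->
  cabs (multi_deriv Dpartial alpha f x) =
  cabs (foldr partial f (multi_seq alpha) x).
Proof.
move=> pf; rewrite multi_derivE foldr_Dpartial // Normc.normcM cabsX.
by rewrite cabsN cabs_i expr1n mul1r.
Qed.

(** * Derivatives of the terms of a Fourier series *)

(** Unlike the operator [partial], this relation applies on any normed space, so
    that complex functions on two spaces can be compared along lines. *)
Definition cderive (R : realType) (V : normedModType R) (x v : V)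
    (f : V -> R[i]) (l : R[i]) :=
  is_derive x v (fun y => complex.Re (f y)) (complex.Re l) /\
  is_derive x v (fun y => complex.Im (f y)) (complex.Im l).

Lemma cderive_along (R : realType) (V V' : normedModType R)
    (f : V -> R[i]) (f' : V' -> R[i]) x v x' v' c l :
  (forall h : R, f (h *: v + x) = c * f' (h *: v' + x')) ->
  cderive x' v' f' l -> cderive x v f (c * l).
Proof.
move=> E [dr di]; rewrite /cderive Re_mulc Im_mulc; split.
  apply: (@is_derive_along _ _ _ _ (complex.Re c *: (fun y => complex.Re (f' y))
     - complex.Im c *: (fun y => complex.Im (f' y))) _ _ x' v') => h.
  by rewrite E Re_mulc.
apply: (@is_derive_along _ _ _ _ (complex.Re c *: (fun y => complex.Im (f' y))
   + complex.Im c *: (fun y => complex.Re (f' y))) _ _ x' v') => h.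
by rewrite E Im_mulc.
Qed.

(** Along a coordinate line, e^(i x eta) is a constant times the exponential of
    one real variable. *)
Lemma expi_shift (R : realType) d (eta : 'rV[int]_d) (x : 'rV[R]_d) j (h : R) :
  expi (h *: delta_mx 0 j + x) eta =
  expi x eta * (cos (h * (eta 0 j)%:~R) +i* sin (h * (eta 0 j)%:~R)).
Proof.
rewrite /expi.
have -> : \sum_k (h *: delta_mx 0 j + x) 0 k * (eta 0 k)%:~R =
   \sum_k x 0 k * (eta 0 k)%:~R + h * (eta 0 j)%:~R.
  under eq_bigr do rewrite !mxE mulrDl.
  rewrite big_split /= addrC; congr (_ + _).
  rewrite (bigD1 j) //= !eqxx mulr1 big1 ?addr0 // => k /negbTE kj.
  by rewrite kj mulr0 mul0r.
by apply: complex_ext; rewrite ?Re_mulc ?Im_mulc /= ?cosD // sinD addrC.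
Qed.

Lemma cderive_expi (R : realType) d (eta : 'rV[int]_d) (x : 'rV[R]_d) j :
  cderive x (delta_mx 0 j) (fun y => expi y eta)
    (expi x eta * ('i * ((eta 0 j)%:~R)%:C)).
Proof.
set a : R := (eta 0 j)%:~R.
apply: (@cderive_along _ _ _ _ (fun u : R => cos (u * a) +i* sin (u * a)) _ _ 0 1).
  by move=> h; rewrite expi_shift addr0 /GRing.scale /= mulr1.
have da : is_derive (0 : R) 1 (fun u => u * a) a.
  rewrite (_ : (fun u => u * a) = a *: id); last first.
    by apply/funext => u; rewrite mulrC.
  by apply: is_derive_eq; rewrite /GRing.scale /= mulr1.
split=> /=; rewrite !mul0r ?mul1r ?sub0r ?add0r ?mulr0.
  have := @is_derive1_comp _ cos (fun u => u * a) 0 _ _ (is_derive_cos _) da.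
  by rewrite mul0r sin0 oppr0 mul0r.
have := @is_derive1_comp _ sin (fun u => u * a) 0 _ _ (is_derive_sin _) da.
by rewrite mul0r cos0 mul1r.
Qed.

Lemma cabs_expi (R : realType) d (x : 'rV[R]_d) (eta : 'rV[int]_d) :
  cabs (expi x eta) = 1.
Proof. by rewrite /= cos2Dsin2 sqrtr1. Qed.

Lemma cos_sin_int_periods (R : realType) (x : R) (n : int) :
  cos (x + 2 * pi * n%:~R) = cos x /\ sin (x + 2 * pi * n%:~R) = sin x.
Proof.
have E (k : nat) : 2 * pi * k%:R = (pi *+ 2) *+ k :> R.
  by rewrite -[RHS]mulr_natr -[pi *+ 2]mulr_natl.
have P (y : R) (k : nat) :
    cos (y + 2 * pi * k%:R) = cos y /\ sin (y + 2 * pi * k%:R) = sin y.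
  by rewrite E; split; [exact: (periodicn (@cosD2pi R))|exact: (periodicn (@sinD2pi R))].
case: n => k; first exact: P.
rewrite NegzE mulrNz mulrN.
have [] := P (x - 2 * pi * k.+1%:R) k.+1.
by rewrite subrK => -> ->.
Qed.

Lemma expi_periodic (R : realType) d (x : 'rV[R]_d) (k eta : 'rV[int]_d) :
  expi (x + (2 * pi) *: map_mx intr k) eta = expi x eta.
Proof.
rewrite /expi.
have -> : \sum_j (x + (2 * pi) *: map_mx intr k) 0 j * (eta 0 j)%:~R =
   \sum_j x 0 j * (eta 0 j)%:~R + 2 * pi * (\sum_j k 0 j * eta 0 j)%:~R.
  rewrite rmorph_sum mulr_sumr -big_split /=; apply: eq_bigr => j _.
  by rewrite !mxE mulrDl rmorphM /= mulrA.
by have [-> ->] := cos_sin_int_periods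
  (\sum_j x 0 j * (eta 0 j)%:~R) (\sum_j k 0 j * eta 0 j).
Qed.

Section FourierTerm.
Variables (R : realType) (r s : nat).
Implicit Types (f : 'rV[R]_r -> R[i]) (eta : 'rV[int]_s) (l : seq 'I_(r + s)).

Definition fourier_term f eta (y : 'rV[R]_(r + s)) : R[i] :=
  f (lsubmx y) * expi (rsubmx y) eta.

Definition left_indices l : seq 'I_r :=
  pmap (fun k : 'I_(r + s) =>
          if fintype.split k is inl j then Some j else None) l.

Definition right_indices l : seq 'I_s :=
  pmap (fun k : 'I_(r + s) =>
          if fintype.split k is inr j then Some j else None) l.

(** The Fourier multiplier of a composition of partial derivatives. *)
Definition symbol eta (l : seq 'I_s) : R[i] :=
  \prod_(j <- l) ('i * ((eta 0 j)%:~R)%:C).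

Lemma size_left_right l :
  (size (left_indices l) + size (right_indices l))%N = size l.
Proof.
elim: l => //= k l IH; case: (fintype.split k) => j /=; first by rewrite addSn IH.
by rewrite addnS IH.
Qed.

Lemma lsubmx_line (k : 'I_r) (h : R) (y : 'rV[R]_(r + s)) :
  lsubmx (h *: delta_mx 0 (lshift s k) + y) = h *: delta_mx 0 k + lsubmx y /\
  rsubmx (h *: delta_mx 0 (lshift s k) + y) = rsubmx y.
Proof.
split; apply/rowP => j; rewrite !mxE; last by rewrite eq_rlshift mulr0 add0r.
by rewrite (inj_eq (@lshift_inj _ _)).
Qed.

Lemma rsubmx_line (k : 'I_s) (h : R) (y : 'rV[R]_(r + s)) :
  rsubmx (h *: delta_mx 0 (rshift r k) + y) = h *: delta_mx 0 k + rsubmx y /\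
  lsubmx (h *: delta_mx 0 (rshift r k) + y) = lsubmx y.
Proof.
split; apply/rowP => j; rewrite !mxE; last by rewrite eq_lrshift mulr0 add0r.
by rewrite (inj_eq (@rshift_inj _ _)).
Qed.

(** The closed form of the derivatives of a term along l, see
    [foldr_fourier_term]. *)
Definition fourier_term_partial f eta l (y : 'rV[R]_(r + s)) : R[i] :=
  symbol eta (right_indices l) *
  fourier_term (foldr partial f (left_indices l)) eta y.

Lemma cderive_fourier_term f eta l k y : has_partials f ->
  cderive y (delta_mx 0 k) (fourier_term_partial f eta l)
    (fourier_term_partial f eta (k :: l) y).
Proof.
move=> pf; rewrite /fourier_term_partial /fourier_term /=.
case: (split_ordP k) => j -> /=.
  rewrite [_ (lsubmx y) * _]mulrC mulrA.
  apply: (@cderive_along _ _ _ _ (foldr partial f (left_indices l)) _ _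
            (lsubmx y) (delta_mx 0 j)) => [h|].
    by have [-> ->] := lsubmx_line j h y; rewrite mulrAC mulrA.
  by split; [exact: (has_partials_Re pf)|exact: (has_partials_Im pf)].
rewrite /symbol big_cons -/(symbol _ _).
rewrite (_ : 'i * _ * _ * _ = symbol eta (right_indices l) *
   foldr partial f (left_indices l) (lsubmx y) *
   (expi (rsubmx y) eta * ('i * ((eta 0 j)%:~R)%:C))); last first.
  ring.
apply: cderive_along (cderive_expi eta (rsubmx y) j) => h.
by have [-> ->] := rsubmx_line j h y; rewrite mulrA.
Qed.

Lemma foldr_fourier_term f eta l : has_partials f ->
  foldr partial (fourier_term f eta) l = fourier_term_partial f eta l.
Proof.
move=> pf; elim: l => [|k l IH] /=.
  by apply/funext => y; rewrite /fourier_term_partial /symbol big_nil mul1r.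
rewrite IH; apply/funext => y; have [dr di] := cderive_fourier_term eta l k y pf.
by apply: complex_ext; rewrite /= /re_part /im_part derive_val.
Qed.

Lemma fourier_term_has_partials f eta :
  has_partials f -> has_partials (fourier_term f eta).
Proof.
move=> pf l k y; rewrite foldr_fourier_term //.
by have [dr di] := cderive_fourier_term eta l k y pf; split; exact: ex_derive.
Qed.

Lemma eucl_ge0 eta : 0 <= eucl R eta.
Proof. exact: sqrtr_ge0. Qed.

Lemma ler_coord_eucl eta j : `|(eta 0 j)%:~R| <= eucl R eta.
Proof.
rewrite -sqrtr_sqr ler_wsqrtr // (bigD1 j) //= lerDl sumr_ge0 // => k _.
exact: sqr_ge0.
Qed.

Lemma cabs_symbol_le eta (l : seq 'I_s) :
  cabs (symbol eta l) <= (1 + eucl R eta) ^+ size l.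
Proof.
rewrite /symbol; elim: l => [|j l IH]; first by rewrite big_nil Normc.normc1.
rewrite big_cons !Normc.normcM cabs_i mul1r cabs_Real exprS.
apply: ler_pM => //; first exact: cabs_ge0.
by rewrite (le_trans (ler_coord_eucl eta j)) // lerDr.
Qed.

Lemma cabs_fourier_term_partial_le f eta l y : has_partials f ->
  cabs (foldr partial (fourier_term f eta) l y) <=
  (1 + eucl R eta) ^+ size (right_indices l) *
  cabs (foldr partial f (left_indices l) (lsubmx y)).
Proof.
move=> pf; rewrite foldr_fourier_term // /fourier_term_partial /fourier_term.
rewrite !Normc.normcM cabs_expi mulr1 ler_wpM2r ?cabs_ge0 //.
exact: cabs_symbol_le.
Qed.

End FourierTerm.

(** * Summability over the lattice *)

(** Comparison with the telescoping sum of 1/k - 1/(k + 1). *)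
Lemma sum_inv_sqr_le (R : realType) n :
  \sum_(k < n) ((1 + k%:R) ^+ 2)^-1 <= 2 :> R.
Proof.
suff : \sum_(k < n.+1) ((1 + k%:R) ^+ 2)^-1 <= 2 - (n.+1%:R)^-1 :> R.
  move=> h; apply: (@le_trans _ _ (2 - (n.+1%:R)^-1)); last first.
    by rewrite lerBlDr lerDl invr_ge0.
  by apply: le_trans h; rewrite big_ord_recr /= lerDl invr_ge0 sqr_ge0.
elim: n => [|n IH]; first by rewrite big_ord1 addr0 expr1n invr1; lra.
rewrite big_ord_recr /= (le_trans (lerD IH (lexx _))) //.
rewrite nat1r -[n.+2%:R]natr1; set x : R := n.+1%:R.
have x0 : 0 < x by rewrite ltr0n.
have -> : 2 - (x + 1)^-1 = 2 - x^-1 + (x * (x + 1))^-1.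
  by field; rewrite !gt_eqF ?ltr_wpDr.
rewrite lerD2l lef_pV2 ?posrE ?mulr_gt0 ?exprn_gt0 ?ltr_wpDr //.
by rewrite expr2 ler_wpM2r ?lerDl // addr_ge0 // ltW.
Qed.

(** Since |eta_j| <= |eta|, each term is at most the product over j of
    (1 + |eta_j|)^(-2).  The sum of these products over a box is the s-th power
    of a sum over an interval of Z, and each of its two halves is at most 2. *)
Lemma lattice_sum_le (R : realType) s (B : {fset 'rV[int]_s}) :
  \sum_(eta <- enum_fset B) ((1 + eucl R eta) ^+ (2 * s))^-1 <= 4 ^+ s.
Proof.
pose w (z : int) : R := ((1 + `|z|%:R) ^+ 2)^-1.
pose W (eta : 'rV[int]_s) : R := \prod_j w (eta 0 j).
have w0 z : 0 <= w z by rewrite invr_ge0 sqr_ge0.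
have W0 eta : 0 <= W eta by exact: prodr_ge0.
have eW eta : ((1 + eucl R eta) ^+ (2 * s))^-1 <= W eta.
  rewrite exprM -exprVn.
  have -> x : x ^+ s = \prod_(j < s) x :> R by rewrite prodr_const card_ord.
  apply: ler_prod => j _; rewrite invr_ge0 sqr_ge0 /=.
  rewrite lef_pV2 ?posrE ?exprn_gt0 ?ltr_wpDr ?eucl_ge0 //.
  rewrite ler_pXn2r ?nnegrE ?addr_ge0 ?eucl_ge0 // lerD2l.
  by rewrite (le_trans _ (ler_coord_eucl R eta j)) // -intr_norm natr_absz.
apply: (le_trans (ler_sum _ (fun eta _ => eW eta))).
(* B lies in the box of vectors with entries of absolute value less than N; the
   box is parametrized by signs and absolute values, where 0 occurs twice *)
pose N := ((\sum_(eta <- enum_fset B) \sum_j `|eta 0%R j|).+1)%N.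
pose dec (p : bool * 'I_N) : int := if p.1 then - (p.2 : nat)%:Z else (p.2 : nat)%:Z.
pose row_of (g : {ffun 'I_s -> bool * 'I_N}) : 'rV[int]_s := \row_j dec (g j).
pose enc (eta : 'rV[int]_s) : {ffun 'I_s -> bool * 'I_N} :=
  [ffun j => (eta 0 j < 0, inord `|eta 0 j|)].
have encK eta : eta \in enum_fset B -> row_of (enc eta) = eta.
  move=> Beta; apply/rowP => j; rewrite mxE ffunE /dec /=.
  rewrite inordK; last first.
    rewrite ltnS (big_rem eta) //= (bigD1 j) //= -addnA; exact: leq_addr.
  by case: ltrP => [/ltr0_norm|/ger0_norm] h; rewrite abszE h ?opprK.
have -> : \sum_(eta <- enum_fset B) W eta =
    \sum_(g <- [seq enc eta | eta <- enum_fset B]) W (row_of g).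
  by rewrite big_map; apply: eq_big_seq => eta /encK ->.
apply: (@le_trans _ _ (\sum_(g <- index_enum _) W (row_of g))).
  apply: ler_sum_subset => //.
  - rewrite map_inj_in_uniq ?fset_uniq // => x y Bx By e.
    by rewrite -(encK _ Bx) -(encK _ By) e.
  - exact: index_enum_uniq.
  - by move=> x _; rewrite mem_index_enum.
under eq_bigr => g _ do [rewrite /W; under eq_bigr => j _ do rewrite mxE].
rewrite -(bigA_distr_bigA (fun (_ : 'I_s) p => w (dec p))) prodr_const card_ord.
apply: lerXn2r; rewrite ?nnegrE ?sumr_ge0 //.
rewrite (eq_bigr (fun p : bool * 'I_N => ((1 + (p.2 : nat)%:R) ^+ 2)^-1)).
  rewrite -(pair_bigA _ (fun (_ : bool) (k : 'I_N) => ((1 + (k : nat)%:R) ^+ 2)^-1)) /=.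
  rewrite big_bool (le_trans (lerD (sum_inv_sqr_le _ _) (sum_inv_sqr_le _ _))) //.
  lra.
by move=> [[] k] _; rewrite /w /dec /= ?abszN.
Qed.

(** * Estimates for the weights *)

(** The ratios m_(n+1) / m_n are nondecreasing, written without division. *)
Lemma weight_ratio_mono (R : realType) (m : nat -> R) n p :
  weight_sequence m -> m n.+1 * m (n + p)%N <= m n * m (n + p).+1.
Proof.
move=> [m0 _ mc _]; elim: p => [|p IH]; first by rewrite addn0 mulrC.
rewrite addnS -(ler_pM2r (m0 (n + p).+1)).
apply: (@le_trans _ _ (m n.+1 * (m (n + p)%N * m (n + p).+2))).
  by rewrite -mulrA -expr2 ler_pM2l ?mc.
by rewrite mulrA [leRHS]mulrAC ler_pM2r.
Qed.

(** By monotonicity of the ratios, moving a unit from the smaller index to the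
    larger one increases m_j m_k; starting with j <= k, the product reaches
    m_0 m_(j + k) = m_(j + k). *)
Lemma weight_supermul (R : realType) (m : nat -> R) j k :
  weight_sequence m -> m j * m k <= m (j + k)%N.
Proof.
move=> wm; wlog jk : j k / (j <= k)%N.
  move=> H; case: (leqP j k) => [|/ltnW]; first exact: H.
  by rewrite mulrC addnC; exact: H.
elim: j k jk => [|j IH] k jk.
  by have [_ [-> _] _ _] := wm; rewrite mul1r.
have /subnKC <- := ltnW jk.
apply: le_trans (weight_ratio_mono j (k - j) wm) _.
by rewrite subnKC ?(ltnW jk) // addSnnS IH // (leq_trans (ltnW jk)).
Qed.

(** One binomial coefficient is at most the sum 2^(j + k) of its row. *)
Lemma fact_add_le j k : ((j + k)`! <= 2 ^ (j + k) * (j`! * k`!))%N.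
Proof.
rewrite -(@bin_fact (j + k) j) ?leq_addr // addKn leq_mul2r orbC.
apply/orP; left; rewrite -[X in (X ^ _)%N]/(1 + 1)%N expnDn.
by rewrite (bigD1 (inord j)) //= inordK ?ltnS ?leq_addr // !exp1n !muln1 leq_addr.
Qed.

Lemma fact_mul_le j k : (j`! * k`! <= (j + k)`!)%N.
Proof.
rewrite -(@bin_fact (j + k) j) ?leq_addr // addKn leq_pmull // bin_gt0.
exact: leq_addr.
Qed.

(** A fixed shift q of the order costs only a geometric factor. *)
Lemma weight_shift_le (R : realType) (m : nat -> R) (H delta : R) k q :
  weight_sequence m -> 0 < delta ->
  (forall j k, m (j + k)%N <= H ^+ (j + k) * m j * m k) ->
  m (k + q)%N * (k + q)`!%:R / delta ^+ (k + q) <=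
  (2 * H / delta) ^+ (k + q) * (m k * m q) * (k`!%:R * q`!%:R).
Proof.
move=> [m0 _ _ _] d0 mH; rewrite ler_pdivrMr ?exprn_gt0 //.
have F : ((k + q)`!%:R : R) <= 2 ^+ (k + q) * (k`!%:R * q`!%:R).
  by rewrite -natrX -!natrM ler_nat fact_add_le.
apply: le_trans (ler_pM _ _ (mH k q) F) _; rewrite ?(ltW (m0 _)) //.
rewrite !exprMn exprVn le_eqVlt; apply/orP; left; apply/eqP.
by field; rewrite expf_neq0 // gt_eqF.
Qed.

(** Orders of differentiation in two groups of variables combine into the total
    order. *)
Lemma weight_product_le (R : realType) (m : nat -> R) (h L : R) a k :
  weight_sequence m -> 0 <= h -> 0 <= L ->
  (h ^+ a * m a * a`!%:R) * (L ^+ k * m k * k`!%:R) <=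
  (h + L) ^+ (a + k) * m (a + k)%N * (a + k)`!%:R.
Proof.
move=> wm h0 L0; have [m0 _ _ _] := wm; have mn n := ltW (m0 n).
rewrite (_ : _ * (_ * _ * _) =
  (h ^+ a * L ^+ k) * (m a * m k) * (a`!%:R * k`!%:R)); last by ring.
have P : h ^+ a * L ^+ k <= (h + L) ^+ (a + k).
  rewrite exprD; apply: ler_pM; rewrite ?exprn_ge0 //;
  by apply: lerXn2r; rewrite ?nnegrE ?addr_ge0 // ?lerDl ?lerDr.
apply: ler_pM; rewrite ?mulr_ge0 ?exprn_ge0 //; last first.
  by rewrite -natrM ler_nat fact_mul_le.
by apply: ler_pM; rewrite ?mulr_ge0 ?exprn_ge0 // weight_supermul.
Qed.

(** The infimum is at most the term of index p = k + q, whose denominator absorbs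
    the k-th power of 1 + |eta| and leaves the q-th. *)
Lemma decay_le (R : realType) (m : nat -> R) (delta : R) s
    (eta : 'rV[int]_s) k q :
  weight_sequence m -> 0 < delta ->
  (1 + eucl R eta) ^+ k *
    inf [set m p * p`!%:R / (delta ^+ p * (1 + eucl R eta) ^+ p)
        | p in [set: nat]] <=
  m (k + q)%N * (k + q)`!%:R / delta ^+ (k + q) *
    ((1 + eucl R eta) ^+ q)^-1.
Proof.
move=> [m0 _ _ _] d0; set E := 1 + eucl R eta.
have E0 : 0 < E by rewrite ltr_wpDr ?eucl_ge0.
set S := (X in inf X).
have lbS : has_lbound S.
  exists 0 => _ [p _ <-].
  by rewrite divr_ge0 ?mulr_ge0 ?exprn_ge0 ?(ltW (m0 _)) // ltW.
have Sp : S (m (k + q)%N * (k + q)`!%:R / (delta ^+ (k + q) * E ^+ (k + q))).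
  by exists (k + q)%N.
have := ge_inf lbS Sp; rewrite -(ler_pM2l (exprn_gt0 k E0)).
move=> /le_trans; apply; rewrite le_eqVlt; apply/orP; left; apply/eqP.
rewrite [E ^+ (k + q)]exprD; field.
by rewrite !expf_neq0 ?gt_eqF.
Qed.

(** * Smoothness and ultradifferentiability of the sum *)

Theorem theorem5p2 (R : realType) (m : nat -> R) (r s : nat)
    (phi : 'rV[int]_s -> 'rV[R]_r -> R[i]) (C h delta : R)
    (hm : weight_sequence m) (hr : (0 < r)%N) (hs : (0 < s)%N)
    (hphi : forall eta : 'rV[int]_s, ultradiff m (phi eta))
    (hC : 0 < C) (hh : 0 < h) (hdelta : 0 < delta)
    (hbound : forall (t : 'rV[R]_r) (alpha : 'I_r -> nat) (eta : 'rV[int]_s),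
      cabs (multi_deriv partial alpha (phi eta) t) <=
      C * h ^+ mlen alpha * m (mlen alpha) * (mlen alpha)`!%:R *
      inf [set m p * p`!%:R / (delta ^+ p * (1 + eucl R eta) ^+ p)
          | p in [set: nat]]) :
  exists Phi : 'rV[R]_(r + s) -> R[i],
    (forall (t : 'rV[R]_r) (x : 'rV[R]_s),
       has_sum (fun eta : 'rV[int]_s => phi eta t * expi x eta)
               (Phi (row_mx t x))) /\
    ultradiff m Phi.
Proof.
have [m0 _ _ [H H1 mH]] := hm.
have mn n : 0 <= m n := ltW (m0 n).
have H0 : 0 < H by exact: lt_trans H1.
have sphi eta : smooth (phi eta) by have [] := hphi eta.
have pphi eta := smooth_has_partials (sphi eta).
(* (1 + |eta|)^(-2 s) is summable over Z^s *)
pose q := (2 * s)%N.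
pose A a : R := C * (h ^+ a * m a * a`!%:R).
pose D k : R := m (k + q)%N * (k + q)`!%:R / delta ^+ (k + q).
pose bound (l : seq 'I_(r + s)) : R :=
  A (size (left_indices l)) * D (size (right_indices l)).
have A0 a : 0 <= A a by rewrite !mulr_ge0 ?exprn_ge0 ?(ltW hC) // ltW.
have D0 k : 0 <= D k by rewrite divr_ge0 ?mulr_ge0 ?exprn_ge0 // ltW.
have term_le eta l y : cabs (foldr partial (fourier_term (phi eta) eta) l y) <=
    bound l * ((1 + eucl R eta) ^+ q)^-1.
  apply: le_trans (cabs_fourier_term_partial_le _ _ _ (pphi eta)) _.
  have E0 : 0 <= 1 + eucl R eta by rewrite addr_ge0 ?eucl_ge0.
  pose J := inf [set m p * p`!%:R / (delta ^+ p * (1 + eucl R eta) ^+ p)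
                | p in [set: nat]].
  have hJ alpha : cabs (multi_deriv partial alpha (phi eta) (lsubmx y)) <=
      A (mlen alpha) * J.
    by rewrite /A mulrA mulrA; exact: hbound.
  have := partial_bound_any_order (b := fun n => A n * J) (sphi eta) hJ
     (left_indices l).
  move=> /(ler_wpM2l (exprn_ge0 (size (right_indices l)) E0)).
  move=> /le_trans; apply; rewrite mulrCA /bound -mulrA ler_wpM2l //.
  exact: decay_le.
have bound0 l : 0 <= bound l by exact: mulr_ge0.
have [|//|l B|Phi sPhi hPhi] := @termwise_smooth R (r + s) _
  (fun eta => fourier_term (phi eta) eta)
  (fun l eta => bound l * ((1 + eucl R eta) ^+ q)^-1)
  (fun l => bound l * 4 ^+ s).
- by move=> eta; exact: fourier_term_has_partials.
- by rewrite -mulr_sumr ler_wpM2l // lattice_sum_le.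
have Phi_le l y : cabs (foldr partial Phi l y) <= bound l * 4 ^+ s.
  apply: has_sum_norm_le (hPhi l y) (fun eta => term_le eta l y) _ => B.
  by rewrite -mulr_sumr ler_wpM2l // lattice_sum_le.
exists Phi; split=> [t x|].
  have := hPhi [::] (row_mx t x); rewrite /= /fourier_term.
  by rewrite row_mxKl row_mxKr.
(* L comes from the shift of the order by q *)
pose L := 2 * H / delta.
have L0 : 0 < L by rewrite divr_gt0 ?mulr_gt0.
split=> //.
  move=> y k; apply: has_sum_unique (hPhi [::] _) _.
  have := hPhi [::] y; congr has_sum; apply/funext => eta /=.
  have [per _ _] := hphi eta; rewrite /fourier_term.
  by rewrite !linearD !linearZ /= -!map_lsubmx -!map_rsubmx per expi_periodic.
exists (C * (L ^+ q * m q * q`!%:R * 4 ^+ s)), (h + L); split.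
- by rewrite !mulr_gt0 ?exprn_gt0 ?ltr0n ?fact_gt0.
- exact: addr_gt0.
move=> y alpha.
rewrite cabs_multi_Dpartial; last exact: smooth_has_partials.
apply: le_trans (Phi_le _ _) _; rewrite -size_multi_seq.
move: (multi_seq alpha) => l; rewrite -(size_left_right l) /bound.
set a := size (left_indices l); set k := size (right_indices l).
have := weight_shift_le k q hm hdelta mH; rewrite -/L -/(D k).
move=> /(ler_wpM2l (A0 a)) /(ler_wpM2r (exprn_ge0 s (ler0n _ 4))).
move=> /le_trans; apply.
rewrite (_ : A a * _ * _ = C * (L ^+ q * m q * q`!%:R * 4 ^+ s) *
  ((h ^+ a * m a * a`!%:R) * (L ^+ k * m k * k`!%:R))); last first.
  by rewrite /A [L ^+ (k + q)]exprD; ring.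
rewrite -[leRHS]mulrA -[leRHS]mulrA ler_wpM2l //.
  by rewrite !mulr_ge0 ?exprn_ge0 // ltW.
by rewrite [leRHS]mulrA; apply: weight_product_le => //; exact: ltW.
Qed.
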